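(* Let $(X,d_X)$ be an $n$-point metric space and $\beta\in(0,1)$ such that every subset $Y\subseteq X$ (with the induced metric) is $(t,|Y|^{-\beta})$-decomposable. Then for every $\epsilon\in(0,1/8)$ there is a $t\cdot(2+\epsilon)$-spanner for $X$ with lightness $O_\epsilon\!\left(\frac{t}{\beta}\cdot n^{\beta}\cdot\log n\right)$ and with $O_\epsilon\!\left(n^{1+\beta}\cdot\log n\cdot\log t\right)$ edges.
   Context: A metric space $(Y,d)$ is $(t,\delta)$-decomposable if for every $\Delta>0$ there is a probability distribution over partitions of $Y$ such that every partition in the support has all clusters of diameter at most $t\cdot\Delta$, and every two points $x,y$ with $d(x,y)\le\Delta$ lie in the same cluster with probability at least $\delta$. A $k$-spanner of $(X,d_X)$ is a weighted graph $H$ on vertex set $X$, each edge $\{x,y\}$ having weight $d_X(x,y)$, such that $d_X(x,y)\le d_H(x,y)\le k\cdot d_X(x,y)$ for all $x,y$, with $d_H$ the shortest-path metric of $H$. The lightness of $H$ is its total weight divided by the weight of a minimum spanning tree of $X$. $O_\epsilon(f)$ means $O(f)\cdot\mathrm{poly}(1/\epsilon)$; logarithms are base 2.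
   Formalization: In the edge bound the factor log t is replaced by max(1, log t), since for t = 1 (or t close to 1) the stated bound fails: a two-point space is (1, 2^{-β})-decomposable with log t = 0, yet any spanner needs an edge. *)

(* Defs.v *)
From HB Require Import structures.
From mathcomp Require Import all_boot all_order all_algebra.
From mathcomp Require Import all_classical all_reals all_analysis.

Set Implicit Arguments.
Unset Strict Implicit.
Unset Printing Implicit Defensive.

Import Order.TTheory GRing.Theory Num.Theory.

Local Open Scope ring_scope.

#[short(type="finMetricType")]
HB.structure Definition FinMetric (R : numDomainType) :=
  { X of Finite X & Metric R X }.

Definition log2 (R : realType) (x : R) : R := ln x / ln 2.

Section Decomposition.
Context {R : realType} {X : finMetricType R}.

Definition is_distr (T : finType) (mu : T -> R) : Prop :=
  (forall a, 0 <= mu a) /\ \sum_a mu a = 1.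

Definition diameter_le (A : {set X}) (r : R) : Prop :=
  forall x y, x \in A -> y \in A -> mdist x y <= r.

Definition same_cluster (P : {set {set X}}) (x y : X) : bool :=
  [exists A in P, (x \in A) && (y \in A)].

(* The subset [Y] carries the metric induced from [X].  As [Y] is finite, so is
   the set of its partitions, and a distribution over them is a mass function. *)
Definition decomposable (Y : {set X}) (t delta : R) : Prop :=
  forall Delta : R, 0 < Delta ->
    exists2 mu : {set {set X}} -> R, is_distr mu &
      (forall P, mu P != 0 ->
         finset.partition P Y /\ forall A, A \in P -> diameter_le A (t * Delta)) /\
      (forall x y, x \in Y -> y \in Y -> mdist x y <= Delta ->
         delta <= \sum_(P | same_cluster P x y) mu P).

End Decomposition.

Record sgraph (X : finType) := SGraph {
  adj :> rel X;
  adj_sym : symmetric adj;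
  adj_irrefl : irreflexive adj }.

Section Graphs.
Context {R : realType} {X : finMetricType R}.
Implicit Types G H : sgraph X.

(* An edge {x, y} appears as both (x, y) and (y, x), hence the halvings. *)
Definition nb_edges G : nat := #|[pred e : X * X | G e.1 e.2]|./2.

Definition weight G : R :=
  (\sum_(e : X * X | G e.1 e.2) mdist e.1 e.2) / 2.

Definition path_length (x : X) (p : seq X) : R :=
  \sum_(e <- zip (x :: p) p) mdist e.1 e.2.

(* [+oo] between vertices in different components. *)
Definition graph_dist G (x y : X) : \bar R :=
  ereal_inf [set l | exists p : seq X,
    [/\ path G x p, last x p = y & l = (path_length x p)%:E]]%classic.

Definition spanner (k : R) H : Prop :=
  forall x y, ((mdist x y)%:E <= graph_dist H x y)%E /\
              (graph_dist H x y <= (k * mdist x y)%:E)%E.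

Definition connected_graph G : Prop := forall x y, connect G x y.

Definition acyclic G : Prop :=
  forall c : seq X, (2 < size c)%N -> ~~ ucycleb G c.

Definition spanning_tree G : Prop := connected_graph G /\ acyclic G.

End Graphs.

(* The infimum is attained: there are finitely many spanning trees, and at
   least one. *)
Definition mst_weight (R : realType) (X : finMetricType R) : R :=
  inf [set w | exists2 T : sgraph X, spanning_tree T & w = weight T]%classic.

(* When [X] has at most one point this is 0 / 0 = 0. *)
Definition lightness (R : realType) (X : finMetricType R) (H : sgraph X) : R :=
  weight H / mst_weight X.

(* Main.v *)
(* With [e = eps / 16], take the scales [Delta_j = D / (1 + e) ^ j] and nested
   [e * Delta_j]-nets [N_j].  At each scale, [O(#|N_j| ^ beta * log n)] partitions
   of [N_j], found greedily instead of by sampling, suffice for every pair at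
   distance about [Delta_j] to share a cluster; the spanner [H] joins every net
   point to the centre of each of its clusters.
   Stretch: a pair at distance about [Delta_j] goes through two net points and a
   common centre, the detours to the net being handled at finer scales.
   Sparsity: the centre of a cluster is a point of lowest level, i.e. one that
   entered the nets first, so an edge of scale [j] is charged to an endpoint whose
   level is within [log_(1+e) (2 t / e)] of [j].
   Lightness: [#|N_j| <= min(n, a / Delta_j)] where [a = O_e(MST)], so the weight of
   scale [j] is [O(t log n * a n ^ beta)] times [min(w_j, 1 / w_j)] with [w_j]
   geometric of ratio [(1 + e) ^ - beta]; the sum over [j] costs only [1 / beta]. *)

Require Import Defs.
From HB Require Import structures.
From mathcomp Require Import all_boot all_order all_algebra.
From mathcomp Require Import all_classical all_reals all_analysis.
From mathcomp Require Import ring lra.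

Set Implicit Arguments.
Unset Strict Implicit.
Unset Printing Implicit Defensive.

Import Order.TTheory GRing.Theory Num.Theory.

Local Open Scope ring_scope.

(** * Averaging over a distribution and greedy covering *)

Lemma exists_ge_mean (R : realType) (T : finType) (mu f : T -> R) (c : R) :
  is_distr mu -> c <= \sum_a mu a * f a -> exists2 a, mu a != 0 & c <= f a.
Proof.
move=> [mu0 mu1] cf; apply: contrapT => no.
have lt_fc a : mu a != 0 -> f a < c.
  by move=> ma; rewrite ltNge; apply/negP => cfa; apply: no; exists a.
have nn a : 0 <= mu a * (c - f a).
  have [->|ma] := eqVneq (mu a) 0; first by rewrite mul0r.
  by rewrite mulr_ge0// subr_ge0 ltW// lt_fc.
have s0 : \sum_a mu a * (c - f a) = 0.
  apply/eqP; rewrite eq_le sumr_ge0 ?andbT//.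
  under eq_bigr do rewrite mulrBr.
  by rewrite sumrB -mulr_suml mu1 mul1r subr_le0.
have := oner_neq0 R; rewrite -mu1 big1 ?eqxx// => a _.
apply/eqP; apply: contrapT => /negP ma.
have /(_ a isT) /eqP := psumr_eq0P (fun a _ => nn a) s0.
rewrite mulf_eq0 (negPf ma) subr_eq0 /= => /eqP ca.
by have := lt_fc a ma; rewrite ca ltxx.
Qed.

(** Replaces independent sampling: by averaging, some [a] of the support covers at least a fraction
    [delta] of what is still uncovered, so each round shrinks the remainder by a factor
    [1 - delta]. *)
Lemma greedy_cover (R : realType) (T E : finType) (mu : T -> R)
    (cov : T -> pred E) (delta : R) (U : {set E}) (m : nat) :
  is_distr mu -> delta <= 1 ->
  (forall e, e \in U -> delta <= \sum_(a | cov a e) mu a) ->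
  exists s : seq T,
    [/\ size s = m, all (fun a => mu a != 0) s &
      #|[set e in U | ~~ has (cov^~ e) s]|%:R <= (1 - delta) ^+ m * #|U|%:R].
Proof.
move=> dmu d1 covU; elim: m => [|m [s [sm mus leU]]].
  exists [::]; split=> //; rewrite expr0 mul1r ler_nat subset_leq_card//.
  by apply/fintype.subsetP => e; rewrite finset.inE => /andP[].
set V := [set e in U | _] in leU.
have [a ma le_a] : exists2 a, mu a != 0 &
    delta * #|V|%:R <= #|[set e in V | cov a e]|%:R.
  apply: (exists_ge_mean dmu).
  under eq_bigr => a _.
    rewrite -sum1_card natr_sum mulr_sumr.
    under eq_bigl do rewrite finset.inE.
    rewrite big_mkcondr /=.
    over.
  rewrite /= exchange_big /= -sum1_card natr_sum mulr_sumr ler_sum// => e.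
  rewrite finset.inE => /andP[eU _]; rewrite mulr1 (le_trans (covU e eU))//.
  by rewrite -big_mkcond /= ler_sum// => a _; rewrite mulr1.
exists (a :: s); split => /=; [by rewrite sm|by rewrite ma mus|].
rewrite exprS -mulrA.
apply: (@le_trans _ _ ((1 - delta) * #|V|%:R)); last first.
  by rewrite ler_wpM2l// subr_ge0.
have -> : [set e in U | ~~ (cov a e || has (cov^~ e) s)] =
    V :\: [set e in V | cov a e].
  apply/finset.setP => e; rewrite !finset.inE negb_or.
  by case: (e \in U); case: (cov a e); case: (has _ _).
have WV : [set e in V | cov a e] \subset V.
  by apply/fintype.subsetP => e; rewrite finset.inE => /andP[].
rewrite cardsD (finset.setIidPr _) // natrB ?subset_leq_card//.
by rewrite mulrBl mul1r lerB.
Qed.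

(** * Derandomized star covers *)

Section StarCover.
Context {R : realType} {X : finMetricType R}.
Implicit Types (Y : {set X}) (P : {set {set X}}) (lev : X -> nat).

(* Picked as a function of the block alone, so that points of a block share their
   centre; [arg min] would also depend on its default [x]. *)
Definition centre lev P (x : X) : X :=
  odflt x [pick z in finset.pblock P x | [forall w in finset.pblock P x, (lev z <= lev w)%N]].

Lemma centreP lev P x : x \in finset.pblock P x ->
  centre lev P x \in finset.pblock P x /\ (lev (centre lev P x) <= lev x)%N.
Proof.
move=> xP; rewrite /centre; case: pickP => [z /andP[zP /forall_inP minz]|no] /=.
  by split=> //; apply: minz.
have [z zP minz] := arg_minnP lev xP.
by have /negP[] := negbT (no z); apply/andP; split=> //; apply/forall_inP.
Qed.

Lemma centre_pblock lev P x y : x \in finset.pblock P x -> finset.pblock P x = finset.pblock P y ->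
  centre lev P x = centre lev P y.
Proof.
move=> xP xy; rewrite /centre -xy; case: pickP => // no.
have [z zP minz] := arg_minnP lev xP.
by have /negP[] := negbT (no z); apply/andP; split=> //; apply/forall_inP.
Qed.

(** The greedy partitions leave fewer than one pair uncovered, hence none; each becomes the map from
    a point to the centre of its cluster. The edge count will need that centres do not raise the
    level. *)
Lemma star_cover Y (t delta Delta : R) lev (m : nat) :
  decomposable Y t delta -> 0 < Delta -> delta <= 1 ->
  (1 - delta) ^+ m * (#|X| ^ 2)%:R < 1 ->
  exists s : seq {ffun X -> X},
    [/\ size s = m,
      forall f x, f \in s -> x \notin Y -> f x = x,
      forall f x, f \in s -> x \in Y ->
        [/\ f x \in Y, mdist x (f x) <= t * Delta & (lev (f x) <= lev x)%N] &
      forall x y, x \in Y -> y \in Y -> mdist x y <= Delta ->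
        exists2 f, f \in s & f x = f y].
Proof.
move=> dec Delta0 delta1 mbig.
have [mu dmu [suppP covP]] := dec Delta Delta0.
pose U := [set e : X * X | [&& e.1 \in Y, e.2 \in Y & mdist e.1 e.2 <= Delta]].
have [|s [sm mus leU]] :=
  @greedy_cover R _ _ mu (fun P e => same_cluster P e.1 e.2) delta U m dmu delta1.
  by move=> e; rewrite finset.inE => /and3P[e1 e2 e12]; apply: covP.
pose F P : {ffun X -> X} := [ffun x => if x \in Y then centre lev P x else x].
have partP P : P \in s -> finset.partition P Y /\
    forall A, A \in P -> diameter_le A (t * Delta).
  by move=> Ps; apply: suppP; exact: (allP mus).
have pbx P x : P \in s -> x \in Y -> x \in finset.pblock P x /\ finset.pblock P x \in P.
  move=> Ps xY; have [/and3P[/eqP covY trP _] _] := partP P Ps.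
  by rewrite finset.mem_pblock finset.pblock_mem covY.
exists (map F s); split; first by rewrite size_map.
- by move=> _ x /mapP[P Ps ->] xY; rewrite ffunE (negPf xY).
- move=> _ x /mapP[P Ps ->] xY; rewrite ffunE xY.
  have [xB BP] := pbx P x Ps xY; have [cB clev] := centreP lev xB.
  have [/and3P[/eqP covY _ _] dP] := partP P Ps.
  split=> //; last exact: dP BP _ _ xB cB.
  by rewrite -covY; apply/bigcupP; exists (finset.pblock P x).
- move=> x y xY yY xy.
  have [P Ps] : exists2 P, P \in s & same_cluster P x y.
    apply/hasP/negPn/negP => nohas.
    have xyU : (x, y) \in [set e in U | ~~ has ((fun P e => same_cluster P e.1 e.2)^~ e) s].
      by rewrite !finset.inE /= xY yY xy nohas.
    have : (1 <= #|[set e in U | ~~ has ((fun P e => same_cluster P e.1 e.2)^~ e) s]|)%N.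
      by rewrite card_gt0; apply/set0Pn; exists (x, y).
    rewrite -(ler_nat R) leNgt => /negP; apply.
    apply: (le_lt_trans leU); apply: le_lt_trans mbig.
    rewrite ler_wpM2l ?exprn_ge0 ?subr_ge0// ler_nat.
    by rewrite -mulnn -card_prod max_card.
  move=> /exists_inP[A AP /andP[xA yA]].
  have [/and3P[_ trP _] _] := partP P Ps.
  exists (F P); first exact: map_f.
  rewrite !ffunE xY yY; have [xB _] := pbx P x Ps xY.
  by apply: centre_pblock => //; rewrite (finset.def_pblock trP AP xA)
    (finset.def_pblock trP AP yA).
Qed.

End StarCover.

(** * Graphs, walks and spanning trees *)

Section StarGraph.
Context {R : realType} {X : finMetricType R}.
Implicit Types (s : seq {ffun X -> X}) (x y : X).

Definition star_rel s : rel X :=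
  [rel x y : X | (x != y) && has (fun f : {ffun X -> X} => (f x == y) || (f y == x)) s].

Lemma star_rel_sym s : symmetric (star_rel s).
Proof.
by move=> x y; rewrite /star_rel /= eq_sym; congr (_ && _); apply: eq_has => f; rewrite orbC.
Qed.

Lemma star_rel_irrefl s : irreflexive (star_rel s).
Proof. by move=> x; rewrite /star_rel /= eqxx. Qed.

Definition star_graph s : sgraph X := SGraph (@star_rel_sym s) (@star_rel_irrefl s).

(** Every edge comes from some [f] sending one endpoint to the other and is charged to it. A
    constant [F] counts the edges, the distance weighs them. *)
Lemma star_graph_sum s (F : X -> X -> R) :
  (forall x y, 0 <= F x y) -> (forall x y, F x y = F y x) ->
  (\sum_(e : X * X | star_graph s e.1 e.2) F e.1 e.2) / 2
    <= \sum_(f <- s) \sum_(x | f x != x) F x (f x).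
Proof.
move=> F0 Fsym.
pose G (f : {ffun X -> X}) x y : R := if (f x == y) && (x != y) then F x y else 0.
have G0 f x y : 0 <= G f x y by rewrite /G; case: ifP.
have sumG f : \sum_x \sum_y G f x y = \sum_(x | f x != x) F x (f x).
  rewrite [RHS]big_mkcond; apply: eq_bigr => x _.
  rewrite (bigD1 (f x)) //= /G eqxx /= big1 ?addr0; first by rewrite eq_sym.
  by move=> y; rewrite eq_sym => /negPf->.
rewrite ler_pdivrMr// mulr_suml.
under [leRHS]eq_bigr do rewrite -sumG mulr_natr mulr2n {2}exchange_big /= -big_split /=.
under [leRHS]eq_bigr do under eq_bigr do rewrite -big_split /=.
under [leRHS]eq_bigr do rewrite pair_big /=.
rewrite exchange_big /= [leLHS]big_mkcond ler_sum// => -[x y] _ /=.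
have S0 : 0 <= \sum_(f <- s) (G f x y + G f y x).
  by apply: sumr_ge0 => f _; rewrite addr_ge0.
case: ifP => // /andP[xy /hasP[f fs fxy]].
rewrite (big_rem f)//= ler_wpDr//.
  by apply: sumr_ge0 => g _; rewrite addr_ge0.
move: fxy; rewrite /G xy (eq_sym y) xy !andbT => /orP[->|->].
  by rewrite ler_wpDr//; case: ifP.
by rewrite (Fsym y) ler_wpDl//; case: ifP.
Qed.

Lemma nb_edges_star_graph s :
  (nb_edges (star_graph s))%:R <= \sum_(f <- s) #|[pred x | f x != x]|%:R :> R.
Proof.
have := @star_graph_sum s (fun _ _ => 1) (fun _ _ => ler01) (fun _ _ => erefl).
have -> : \sum_(f <- s) \sum_(x | f x != x) 1 =
    \sum_(f <- s) #|[pred x | f x != x]|%:R :> R.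
  by apply: eq_bigr => f _; rewrite -sum1_card natr_sum.
apply: le_trans; rewrite ler_pdivlMr//.
have -> : \sum_(e : X * X | star_graph s e.1 e.2) 1 =
    #|[pred e : X * X | star_graph s e.1 e.2]|%:R :> R.
  by rewrite -sum1_card natr_sum.
rewrite -natrM ler_nat muln2 /nb_edges.
by rewrite -[leqRHS]odd_double_half leq_addl.
Qed.

Lemma weight_star_graph s :
  weight (star_graph s) <= \sum_(f <- s) \sum_x mdist x (f x).
Proof.
apply: le_trans (star_graph_sum s (@mdist_ge0 R X) (@metric_sym R X)) _.
apply: ler_sum => f _; rewrite big_mkcond ler_sum// => x _.
by case: ifP => // _; apply: mdist_ge0.
Qed.

End StarGraph.

Section Walks.
Context {R : realType} {X : finMetricType R}.
Implicit Types (G : sgraph X) (x y z : X) (l : R).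

(** Bounds on explicit walks add up under concatenation, which postpones the infimum of [graph_dist]
    to the very end. *)
Definition walk_le G x y l :=
  exists p, [/\ path G x p, last x p = y & path_length x p <= l].

Lemma path_length_cons x y (p : seq X) :
  path_length x (y :: p) = mdist x y + path_length y p.
Proof. by rewrite /path_length /= big_cons. Qed.

Lemma path_length_nil x : path_length x [::] = 0.
Proof. by rewrite /path_length /= big_nil. Qed.

Lemma path_length_cat x (p q : seq X) :
  path_length x (p ++ q) = path_length x p + path_length (last x p) q.
Proof.
elim: p x => [|y p IH] x /=; first by rewrite path_length_nil add0r.
by rewrite !path_length_cons IH addrA.
Qed.

Lemma mdist_le_path_length x (p : seq X) : mdist x (last x p) <= path_length x p.
Proof.
elim: p x => [|y p IH] x /=; first by rewrite mdistxx path_length_nil.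
rewrite path_length_cons; apply: le_trans (metric_triangle x y _) _.
by rewrite lerD2l.
Qed.

Lemma walk_le_refl G x : walk_le G x x 0.
Proof. by exists [::]; rewrite path_length_nil. Qed.

Lemma walk_le_trans G x y z l l' :
  walk_le G x y l -> walk_le G y z l' -> walk_le G x z (l + l').
Proof.
move=> [p [pG py pl]] [q [qG qz ql]]; exists (p ++ q).
by rewrite cat_path pG py last_cat path_length_cat py lerD.
Qed.

Lemma walk_le_weaken G x y l l' : l <= l' -> walk_le G x y l -> walk_le G x y l'.
Proof. by move=> ll' [p [pG py pl]]; exists p; split=> //; apply: le_trans ll'. Qed.

Lemma walk_le_edge G x y : G x y -> walk_le G x y (mdist x y).
Proof.
by move=> xy; exists [:: y]; rewrite /= xy path_length_cons path_length_nil addr0.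
Qed.

Lemma walk_le_star (s : seq {ffun X -> X}) f x y : f \in s -> f x = f y ->
  walk_le (star_graph s) x y (mdist x (f x) + mdist y (f y)).
Proof.
move=> fs fxy; have edge z : walk_le (star_graph s) z (f z) (mdist z (f z)) /\
    walk_le (star_graph s) (f z) z (mdist z (f z)).
  have [<-|zfz] := eqVneq z (f z); first by rewrite mdistxx; split; apply: walk_le_refl.
  have adjz : star_graph s z (f z).
    by rewrite /= /star_rel /= zfz; apply/hasP; exists f; rewrite // eqxx.
  split; first exact: walk_le_edge.
  by rewrite metric_sym; apply: walk_le_edge; rewrite adj_sym.
apply: walk_le_trans (edge x).1 _; rewrite fxy; exact: (edge y).2.
Qed.

Lemma walk_le_spanner G k :
  (forall x y, walk_le G x y (k * mdist x y)) -> spanner k G.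
Proof.
move=> wk x y; split.
  apply: le_ereal_inf_tmp => _ [p [_ <- ->]].
  by rewrite lee_fin mdist_le_path_length.
have [p [pG py pl]] := wk x y.
apply: (@le_trans _ _ (path_length x p)%:E); last by rewrite lee_fin.
by apply: ereal_inf_lbound; exists p.
Qed.

End Walks.

(** * Packings and the weight of spanning trees *)

Section PackingWeight.
Context {R : realType} {X : finMetricType R}.
Implicit Types (G : sgraph X) (N : {set X}) (x y u v : X).

(** Telescoping along a path from [u] to [v], made simple so that its steps are distinct terms of
    the sum. *)
Lemma variation_ge G (f : X -> R) u v : connected_graph G ->
  f u - f v <= \sum_(e : X * X | G e.1 e.2) `|f e.1 - f e.2|.
Proof.
move=> /(_ u v) /connectP[p0 p0G ->].
case/shortenP: p0G => p pG pu _.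
have Pp : \sum_(e <- zip (u :: p) p) `|f e.1 - f e.2| <=
    \sum_(e : X * X | G e.1 e.2) `|f e.1 - f e.2|.
  have uz : uniq (zip (u :: p) p) by apply: zip_uniqr; case/andP: pu.
  have zG : all (fun e => G e.1 e.2) (zip (u :: p) p).
    by elim: p u pG {pu uz} => //= y p IH x /andP[-> /IH].
  rewrite big_uniq //= [leRHS]big_mkcond [leLHS]big_mkcond ler_sum// => e _.
  by case: ifPn => [/(allP zG) -> //|_]; case: ifP.
apply: le_trans Pp; elim: p u {pG pu} => [|y p IH] u /=.
  by rewrite big_nil subrr.
rewrite big_cons /= -(subrK (f y) (f u)) -addrA lerD//.
by rewrite subrK ler_norm.
Qed.

Definition tent (r : R) u x : R := Num.max 0 (r - mdist u x).

Lemma tent_lip r u x y : `|tent r u x - tent r u y| <= mdist x y.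
Proof.
have h1 := metric_triangle u x y; have h2 := metric_triangle u y x.
rewrite (metric_sym y x) in h2; have h3 := mdist_ge0 x y.
rewrite /tent ler_norml; case: (lerP 0 (r - mdist u x)) => ?;
  case: (lerP 0 (r - mdist u y)) => ?; apply/andP; split; lra.
Qed.

Lemma card_tent_support N (delta : R) x :
  (forall u v, u \in N -> v \in N -> u != v -> delta <= mdist u v) ->
  (#|[pred u in N | tent (delta / 2) u x != 0%R]| <= 1)%N.
Proof.
move=> sep; apply/card_le1_eqP => u v.
have near w : tent (delta / 2) w x != 0 -> mdist w x < delta / 2.
  apply: contra_neqT; rewrite -leNgt /tent => ?.
  by apply: max_l; rewrite subr_le0.
rewrite !finset.inE => /andP[uN /near ux] /andP[vN /near vx]; apply/eqP.
apply: contraT => uv; have := sep v u vN uN uv.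
have := metric_triangle v x u; rewrite (metric_sym x u).
move: ux vx; lra.
Qed.

(* Tents of radius delta/2 around the points of the packing have disjoint
   supports, so an edge meets at most two of them, while every tent must be
   climbed by the edges of a connected graph. *)
Lemma packing_weight G N (delta : R) : connected_graph G -> (1 < #|N|)%N ->
  (forall u v, u \in N -> v \in N -> u != v -> delta <= mdist u v) ->
  delta * #|N|%:R <= 8 * weight G.
Proof.
move=> cG N1 sep; set r := delta / 2.
have supp x : \sum_(u in N) (tent r u x != 0)%:R <= 1 :> R.
  have := card_tent_support x sep; rewrite -(ler_nat R); apply: le_trans.
  rewrite -sum1_card natr_sum [leRHS]big_mkcond [leLHS]big_mkcond ler_sum// => u _.
  by rewrite finset.inE; case: (u \in N); case: eqP.
(* Only a tent nonzero at an endpoint varies along the edge, by at most its length, and each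
   endpoint sees at most one tent. *)
have edge x y : \sum_(u in N) `|tent r u x - tent r u y| <= 2 * mdist x y.
  apply: (@le_trans _ _ (\sum_(u in N)
      ((tent r u x != 0)%:R + (tent r u y != 0)%:R) * mdist x y)).
    apply: ler_sum => u _.
    move: (tent_lip r u x y) (mdist_ge0 x y).
    case: eqP => [->|_]; case: eqP => [->|_] /=; rewrite ?subrr ?normr0; lra.
  by rewrite -mulr_suml ler_wpM2r ?mdist_ge0// big_split /= lerD.
(* From [u] to another point of [N], at distance at least [2 * r], the tent at [u] falls by at least
   [r]. *)
have climb u : u \in N ->
    r <= \sum_(e : X * X | G e.1 e.2) `|tent r u e.1 - tent r u e.2|.
  move=> uN; have [v vN vu] : exists2 v, v \in N & v != u.
    have : (0 < #|N :\ u|)%N by move: N1; rewrite (cardsD1 u) uN.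
    by rewrite card_gt0 => /set0Pn[v]; rewrite !finset.inE => /andP[vu vN]; exists v.
  apply: le_trans (variation_ge (tent r u) u v cG).
  have := sep u v uN vN; rewrite eq_sym vu => /(_ isT) uv.
  rewrite /tent mdistxx.
  have := mdist_ge0 u v; rewrite /r.
  case: (lerP 0 (delta / 2 - 0)) => ?; case: (lerP 0 (delta / 2 - mdist u v)) => ? ?; lra.
have : \sum_(u in N) r <= \sum_(u in N)
    \sum_(e : X * X | G e.1 e.2) `|tent r u e.1 - tent r u e.2|.
  by apply: ler_sum.
rewrite exchange_big /= sumr_const -mulr_natr => le1.
have {le1} := le_trans le1 (ler_sum _ (fun e _ => edge e.1 e.2)).
(* The 8 is a product of three twos: [r = delta / 2], two tents per edge, and each edge summed in
   both orientations. *)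
rewrite -mulr_sumr /weight /r; lra.
Qed.

(* Makes [mst_weight] an infimum over a nonempty set. *)
Lemma spanning_tree_star (c : X) : spanning_tree (star_graph [:: [ffun=> c]]).
Proof.
have star_c x y : star_graph [:: [ffun=> c]] x y = (x != y) && ((x == c) || (y == c)).
  by rewrite /= /star_rel /= !ffunE orbF orbC !(eq_sym c).
split=> [x y|].
  have toc z : connect (star_graph [:: [ffun=> c]]) z c.
    have [->|zc] := eqVneq z c; first exact: connect0.
    by apply: connect1; rewrite star_c zc eqxx orbT.
  apply: connect_trans (toc x) _.
  by rewrite (sym_connect_sym (@star_rel_sym _ _ _)).
have adj2 x y : star_graph [:: [ffun=> c]] x y -> (c == x) || (c == y).
  by rewrite star_c !(eq_sym c) => /andP[].
(* All edges contain [c], which a cycle visits at most once: a triangle has an edge avoiding it, and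
   a longer cycle has two disjoint edges, [x y] and [z w]. *)
case=> [|x [|y [|z r]]] // _; apply/negP => /andP[].
rewrite /cycle /= !in_cons => /and3P[/adj2 xy /adj2 yz].
case: r => [|w r] /=.
  rewrite orbF => /andP[/adj2 zx _] /and3P[].
  case/orP: xy yz zx => /eqP <-; rewrite eqxx ?orbT /=.
    by move=> /orP[]/eqP <-; rewrite eqxx ?orbT.
  by move=> _ /orP[]/eqP <-; rewrite eqxx ?orbT.
rewrite !in_cons => /andP[/adj2 zw _] /and3P[+ + _].
by case/orP: xy => /eqP <-; case/orP: zw => /eqP <-; rewrite eqxx ?orbT.
Qed.

Lemma packing_mst N (delta : R) : (1 < #|N|)%N ->
  (forall u v, u \in N -> v \in N -> u != v -> delta <= mdist u v) ->
  delta * #|N|%:R <= 8 * mst_weight X.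
Proof.
move=> N1 sep; have [c cN] : exists c, c \in N.
  by apply/set0Pn; rewrite -card_gt0 ltnW.
rewrite -ler_pdivrMl//; apply: lb_le_inf.
  exists (weight (star_graph [:: [ffun=> c]])), (star_graph [:: [ffun=> c]]) => //.
  exact: spanning_tree_star.
move=> _ [T [cT _] ->]; rewrite ler_pdivrMl//.
exact: packing_weight.
Qed.

End PackingWeight.
(** * Nets *)

Section Nets.
Context {R : realType} {X : finMetricType R}.

Definition packing (r : R) (A : {set X}) : bool :=
  [forall x in A, forall y in A, (x != y) ==> (r <= mdist x y)].

Lemma packingP r (A : {set X}) :
  reflect (forall x y, x \in A -> y \in A -> x != y -> r <= mdist x y) (packing r A).
Proof.
apply: (iffP idP) => [pA x y xA yA xy|h].
  by have /forall_inP/(_ y yA)/implyP/(_ xy) := forall_inP pA x xA.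
apply/forall_inP => x xA; apply/forall_inP => y yA; apply/implyP; exact: h.
Qed.

(** Each net is a maximal packing extending the previous one, which is still a packing since the
    radii do not increase; maximality gives the covering. *)
Lemma nested_nets (r : nat -> R) :
  (forall j, 0 <= r j) -> (forall j, r j.+1 <= r j) ->
  exists N : nat -> {set X},
    [/\ forall j x y, x \in N j -> y \in N j -> x != y -> r j <= mdist x y,
        forall i j, (i <= j)%N -> N i \subset N j &
        forall j x, exists2 y, y \in N j & mdist x y <= r j].
Proof.
move=> r0 rS.
pose ext (s : R) (C : {set X}) : {set X} :=
  odflt finset.set0 [pick A | maxset (packing s) A && (C \subset A)].
have extP s C : packing s C -> maxset (packing s) (ext s C) /\ C \subset ext s C.
  move=> pC; rewrite /ext; case: pickP => [A /andP[]//|no].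
  have [A mA CA] := maxset_exists pC.
  by have := no A; rewrite mA CA.
pose N := fix N j := if j is i.+1 then ext (r j) (N i) else ext (r 0%N) finset.set0.
have p0 : packing (r 0%N) finset.set0 by apply/packingP => x y; rewrite finset.inE.
have pS j : maxset (packing (r j)) (N j) -> packing (r j.+1) (N j).
  move=> /maxsetp/packingP pN; apply/packingP => x y xN yN xy.
  exact: le_trans (rS j) (pN x y xN yN xy).
have maxN j : maxset (packing (r j)) (N j).
  elim: j => [|j /pS/extP[]]; last by [].
  by have [] := extP _ _ p0.
exists N; split=> [j|i j /subnK <-|j x].
- by apply/packingP/maxsetp.
- elim: (j - i)%N => // k IH; apply: (fintype.subset_trans IH).
  by have [] := extP _ _ (pS _ (maxN (k + i)%N)).
- apply: contrapT => far.
  have far' y : y \in N j -> r j < mdist x y.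
    by move=> yN; rewrite ltNge; apply/negP => ?; apply: far; exists y.
  have pNj := packingP _ _ (maxsetp (maxN j)).
  have pxN : packing (r j) (x |: N j).
    apply/packingP => u v; rewrite !in_setU1.
    move=> /orP[/eqP->|uN] /orP[/eqP->|vN]; rewrite ?eqxx// => uv.
    - exact/ltW/far'.
    - by rewrite metric_sym; exact/ltW/far'.
    - exact: pNj.
  have xN : x \in N j by rewrite -(maxsetsup (maxN j) pxN (finset.subsetUr _ _)) setU11.
  by have := far' x xN; rewrite mdistxx ltNge r0.
Qed.

End Nets.

(** * Real estimates *)

Section RealEstimates.
Context {R : realType}.
Implicit Types (e t beta : R).

Lemma ln1D_ge e : 0 < e -> e <= 1 -> e / 2 <= ln (1 + e).
Proof.
move=> e0 e1; rewrite -ler_expR lnK ?posrE; last by lra.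
have h : (1 - e / 2) * expR (e / 2) <= 1.
  rewrite -[leRHS](expRxMexpNx_1 (e / 2)) mulrC ler_wpM2l ?expR_ge0//.
  exact: expR_ge1Dx.
have := expR_ge0 (e / 2); nra.
Qed.

Lemma ln2_gt0 : 0 < ln 2 :> R. Proof. by apply: ln_gt0; lra. Qed.

Lemma ln_le_log2 (x : R) : 1 <= x -> ln x <= log2 x.
Proof.
move=> x1; rewrite /log2 ler_pdivlMr ?ln2_gt0// ler_piMr ?ln_ge0//.
by rewrite (_ : 2 = 1 + 1)//; apply: le_ln1Dx; lra.
Qed.

Lemma log2_ge1 n : (2 <= n)%N -> 1 <= log2 n%:R :> R.
Proof.
move=> n2; rewrite /log2 ler_pdivlMr ?ln2_gt0// mul1r ler_ln ?posrE//.
- by rewrite (ler_nat R 2).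
- by rewrite ltr0n; apply: leq_trans n2.
Qed.

(* [expR (- delta * m) < n ^- 2] as soon as [m > 2 ln n / delta]. *)
Lemma sample_size n (delta : R) : (2 <= n)%N -> 0 < delta -> delta <= 1 ->
  exists m : nat, (1 - delta) ^+ m * (n ^ 2)%:R < 1 /\
    m%:R <= 3 * delta^-1 * log2 n%:R :> R.
Proof.
move=> n2 d0 d1; set l : R := ln n%:R.
have n1 : 1 <= n%:R :> R by rewrite ler1n; apply: leq_trans n2.
have n0 : 0 < n%:R :> R by apply: lt_le_trans n1.
have l0 : 0 <= l by apply: ln_ge0.
exists (Num.truncn (2 * l / delta)).+1.
have ld0 : 0 <= 2 * l / delta by rewrite divr_ge0 ?mulr_ge0// ltW.
have /andP[tlo thi] := truncn_itv ld0; split.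
  have -> : (n ^ 2)%:R = expR (2 * l) :> R by rewrite natrX mulrC expRM_natr lnK ?posrE.
  apply: (@le_lt_trans _ _ (expR (- delta) ^+ (Num.truncn (2 * l / delta)).+1 * expR (2 * l))).
    rewrite ler_wpM2r ?expR_ge0//; apply: lerXn2r; rewrite ?nnegrE ?subr_ge0 ?expR_ge0//.
    exact: expR_ge1Dx.
  rewrite -expRM_natr -expRD expR_lt1.
  by move: thi; rewrite ltr_pdivrMr// => thi; lra.
(* Rounding up adds one, which this bound absorbs: hence 3 rather than 2. *)
have dl1 : 1 <= delta^-1 * log2 n%:R.
  by rewrite -[leLHS]mul1r ler_pM// ?log2_ge1// invf_ge1.
have dl2 : l * delta^-1 <= delta^-1 * log2 n%:R.
  by rewrite mulrC ler_wpM2l ?invr_ge0 ?(ltW d0)//; exact: ln_le_log2.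
rewrite -natr1; lra.
Qed.

(** Bounds how many scales can charge an edge to the same point. With [M] the maximum, logarithms
    give [k * (e / 2) <= ln 2 + ln t - ln e <= 3 * (M / e)]; the seventh unit pays for the added
    1. *)
Lemma level_span e t k : 0 < e -> e <= 1 -> 1 <= t -> (1 + e) ^+ k * e <= 2 * t ->
  k%:R + 1 <= 7 / e ^+ 2 * Num.max 1 (log2 t).
Proof.
move=> e0 e1 t1 ket; set M := Num.max 1 _.
have q0 : 0 < 1 + e by lra.
have t0 : 0 < t by lra.
have M1 : 1 <= M by rewrite le_max lexx.
have Mt : ln t <= M by rewrite le_max ln_le_log2 ?orbT.
have ln2 : ln 2 <= 1 :> R by rewrite (_ : 2 = 1 + 1)//; apply: le_ln1Dx; lra.
have lne : - ln e <= e^-1 by rewrite -lnV ?posrE// ltW// ln_sublinear// invr_gt0.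
have : ln ((1 + e) ^+ k * e) <= ln (2 * t).
  by rewrite ler_ln ?posrE ?mulr_gt0 ?exprn_gt0//.
rewrite !lnM ?posrE ?exprn_gt0//.
rewrite lnXn// -[_ *+ k]mulr_natl => kln.
have kle : k%:R * (e / 2) <= k%:R * ln (1 + e) by rewrite ler_wpM2l// ln1D_ge.
have ie1 : 1 <= e^-1 by rewrite invf_ge1.
have Mie : M <= M * e^-1 by rewrite ler_peMr//; lra.
have ieM : e^-1 <= M * e^-1 by rewrite ler_peMl//; lra.
have k6 : k%:R * e <= 6 * (M * e^-1) by lra.
rewrite -(ler_pM2r e0) mulrDl mul1r.
have -> : 7 / e ^+ 2 * M * e = 7 * (M * e^-1) by field; rewrite gt_eqF.
lra.
Qed.

(* The induction keeps the sharper bounds [w / (1 - rho)] for [w <= 1] and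
   [(2 - rho / w) / (1 - rho)] for [w > 1]. *)
Lemma sum_min_geometric (rho w : R) J : 0 < rho -> rho < 1 -> 0 < w ->
  \sum_(j < J) Num.min (w * rho ^+ j) (w * rho ^+ j)^-1 <= 2 / (1 - rho).
Proof.
move=> rho0 rho1; set c := (1 - rho)^-1.
have c0 : 0 < c by rewrite invr_gt0; lra.
have cE : c = 1 + rho * c by rewrite /c; field; lra.
have shift w' J' : \sum_(j < J'.+1) Num.min (w' * rho ^+ j) (w' * rho ^+ j)^-1 =
    Num.min w' w'^-1 +
    \sum_(j < J') Num.min (w' * rho * rho ^+ j) (w' * rho * rho ^+ j)^-1.
  rewrite big_ord_recl expr0 mulr1; congr (_ + _).
  by apply: eq_bigr => j _; rewrite lift0 exprS mulrA.
have low J' w' : 0 < w' -> w' <= 1 ->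
    \sum_(j < J') Num.min (w' * rho ^+ j) (w' * rho ^+ j)^-1 <= w' * c.
  elim: J' w' => [|J' IH] w' w0 w1; first by rewrite big_ord0 mulr_ge0// ltW.
  rewrite shift; have := IH (w' * rho) (mulr_gt0 w0 rho0).
  have -> : w' * rho <= 1 by nra.
  have : Num.min w' w'^-1 <= w' by rewrite ge_min lexx.
  move=> h1 /(_ isT) h2; rewrite cE mulrDr mulr1 mulrA; exact: lerD.
have high J' w' : 1 < w' ->
    \sum_(j < J') Num.min (w' * rho ^+ j) (w' * rho ^+ j)^-1 <= 2 * c - rho * c / w'.
  elim: J' w' => [|J' IH] w' w1.
    rewrite big_ord0; have : w'^-1 <= 1 by rewrite invf_le1; lra.
    have : 0 < w'^-1 by rewrite invr_gt0; lra.
    nra.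
  have w0 : 0 < w' by lra.
  rewrite shift; have minw : Num.min w' w'^-1 <= w'^-1 by rewrite ge_min lexx orbT.
  have [wr|wr] := lerP (w' * rho) 1.
    have := low J' (w' * rho) (mulr_gt0 w0 rho0) wr.
    have : w' * rho * c <= c by rewrite ler_piMl// ltW.
    have : w'^-1 + rho * c / w' <= c.
      rewrite -[X in X + _]mul1r -mulrDl -cE ler_piMr ?(ltW c0)// invf_le1 ?(ltW w1)//.
    lra.
  have := IH _ wr.
  have -> : rho * c / (w' * rho) = c / w' by field; lra.
  have -> : c / w' = w'^-1 + rho * c / w' by rewrite {1}cE mulrDl mul1r.
  lra.
move=> w0; have [w1|w1] := lerP w 1.
  by apply: le_trans (low J w w0 w1) _; rewrite ler_wpM2r ?(ltW c0)//; lra.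
apply: le_trans (high J w w1) _; rewrite gerBl divr_ge0 ?mulr_ge0 ?ltW//; lra.
Qed.

(** With [x = beta * (e / 2) <= 1 / 2], the inverse of the ratio is at least [1 + x], so one minus
    the ratio is at least [x / (1 + x) >= beta * e / 3]. The [1 / beta] of the lightness comes from
    here. *)
Lemma powR_opp_lt1 e beta : 0 < e -> e <= 1 -> 0 < beta -> beta < 1 ->
  (1 + e) `^ (- beta) < 1 /\ (1 - (1 + e) `^ (- beta))^-1 <= 3 / (beta * e).
Proof.
move=> e0 e1 b0 b1; have q0 : 0 < 1 + e by lra.
set P := (1 + e) `^ beta.
have P1 : 1 + beta * (e / 2) <= P.
  rewrite /P -[1 + e]lnK ?posrE// -expRM.
  apply: le_trans (expR_ge1Dx _); rewrite lerD2l mulrC.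
  by rewrite ler_wpM2r ?(ltW b0)//; exact: ln1D_ge.
have be0 : 0 < beta * e by rewrite mulr_gt0.
have be1 : beta * e <= 1 by nra.
have P0 : 0 < P by lra.
have PV : P * P^-1 = 1 by rewrite divff// gt_eqF.
rewrite powRN -/P; have lt1 : P^-1 < 1 by rewrite invf_lt1//; lra.
split=> //; rewrite -lef_pV2 ?posrE ?invr_gt0 ?divr_gt0//; try lra.
rewrite invrK invf_div.
have : P^-1 * (1 + beta * (e / 2)) <= 1.
  by rewrite mulrC ler_pdivrMr// mul1r.
nra.
Qed.

(* With [z = Delta n / a], the bounds [c <= n] and [c <= a / Delta] give
   respectively the factors [z] and [z ^- beta]. *)
Lemma scale_term beta (n a Delta c : R) :
  0 < beta -> beta < 1 -> 0 < n -> 0 < a -> 0 < Delta -> 0 <= c -> c <= n ->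
  Delta * c <= a ->
  Delta * c * c `^ beta <= a * n `^ beta *
    Num.min ((Delta * n / a) `^ beta) ((Delta * n / a) `^ beta)^-1.
Proof.
move=> b0 b1 n0 a0 D0 c0 cn Dca; set z := Delta * n / a.
have z0 : 0 < z by rewrite divr_gt0 ?mulr_gt0.
have nb0 : 0 <= n `^ beta by apply: powR_ge0.
have cb0 : 0 <= c `^ beta by apply: powR_ge0.
have mono x y : 0 <= x -> x <= y -> x `^ beta <= y `^ beta.
  move=> x0 xy; apply: ge0_ler_powR; rewrite ?nnegrE// ?(ltW b0)//.
  exact: le_trans xy.
rewrite minr_pMr; last by rewrite mulr_ge0// ltW.
rewrite le_min; apply/andP; split.
- have [z1|z1] := lerP z 1.
    have zz : z <= z `^ beta by rewrite ger1_powR ?z0// ltW.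
    apply: (@le_trans _ _ (a * n `^ beta * z)); last first.
      by rewrite ler_wpM2l// mulr_ge0// ltW.
    have -> : a * n `^ beta * z = Delta * n * n `^ beta.
      by rewrite /z; move: (n `^ beta) => p; field; rewrite gt_eqF.
    apply: ler_pM; rewrite ?mulr_ge0 ?(ltW D0)//.
      by rewrite ler_wpM2l// ltW.
    exact: mono.
  have zb : 1 <= z `^ beta by rewrite -[leLHS](powRr0 z) ler_powR// ltW.
  apply: (@le_trans _ _ (a * n `^ beta)); last first.
    by rewrite ler_peMr// mulr_ge0// ltW.
  by apply: ler_pM; rewrite ?mulr_ge0 ?(ltW D0)//; exact: mono.
- have -> : a * n `^ beta * (z `^ beta)^-1 = a * (a / Delta) `^ beta.
    have -> : n = z * (a / Delta) by rewrite /z; field; rewrite !gt_eqF.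
    rewrite (powRM _ (ltW z0)) ?divr_ge0 ?ltW//.
    have : z `^ beta != 0 by rewrite gt_eqF// powR_gt0.
    move: (z `^ beta) (_ `^ beta) => p p' p0; by field.
  apply: ler_pM; rewrite ?mulr_ge0 ?(ltW D0)//; apply: mono => //.
  by rewrite ler_pdivlMr// mulrC.
Qed.

(** [scale_term] bounds the summands by a two-sided geometric series of ratio [rho], whence a bound
    independent of [J]; 6 is 2 from [sum_min_geometric] times 3 from [powR_opp_lt1]. *)
Lemma scale_sum e beta (n a D : R) (c : nat -> R) J :
  0 < e -> e <= 1 -> 0 < beta -> beta < 1 -> 0 < n -> 0 < a -> 0 < D ->
  (forall j, 0 <= c j) -> (forall j, c j <= n) ->
  (forall j, D / (1 + e) ^+ j * c j <= a) ->
  \sum_(j < J) D / (1 + e) ^+ j * c j * c j `^ beta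
    <= 6 * a * n `^ beta / (beta * e).
Proof.
move=> e0 e1 b0 b1 n0 a0 D0 c0 cn ca.
have [rho1 rhoV] := powR_opp_lt1 e0 e1 b0 b1.
set rho := (1 + e) `^ (- beta) in rho1 rhoV.
have q0 : 0 < 1 + e by lra.
have rho0 : 0 < rho by apply: powR_gt0.
have w0 : 0 < (D * n / a) `^ beta by rewrite powR_gt0 ?divr_gt0 ?mulr_gt0.
have wE j : (D / (1 + e) ^+ j * n / a) `^ beta = (D * n / a) `^ beta * rho ^+ j.
  have -> : D / (1 + e) ^+ j * n / a = (D * n / a) * ((1 + e) ^+ j)^-1.
    by move: (((1 + e) ^+ j)^-1) => p; field; rewrite gt_eqF.
  rewrite powRM ?invr_ge0 ?exprn_ge0 ?(ltW q0)//; last first.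
    by rewrite ltW ?divr_gt0 ?mulr_gt0.
  have -> : ((1 + e) ^+ j)^-1 = (1 + e) `^ (- j%:R) by rewrite powR_invn// ltW.
  have -> : rho ^+ j = rho `^ j%:R by rewrite powR_mulrn// ltW.
  by rewrite /rho -[in LHS]powRrM -[in RHS]powRrM !mulNr (mulrC beta).
apply: (@le_trans _ _ (\sum_(j < J) a * n `^ beta *
    Num.min ((D * n / a) `^ beta * rho ^+ j) ((D * n / a) `^ beta * rho ^+ j)^-1)).
  apply: ler_sum => j _; rewrite -wE; apply: scale_term => //.
  by rewrite divr_gt0// exprn_gt0.
rewrite -mulr_sumr.
apply: (@le_trans _ _ (a * n `^ beta * (2 * (3 / (beta * e))))).
  rewrite ler_wpM2l ?mulr_ge0 ?powR_ge0 ?(ltW a0)//.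
  apply: le_trans (sum_min_geometric J rho0 rho1 w0) _.
  by rewrite ler_wpM2l.
rewrite le_eqVlt; apply/orP; left; apply/eqP; move: (n `^ beta) ((beta * e)^-1) => p r.
by ring.
Qed.

End RealEstimates.

(** * Extreme distances and positivity in a finite metric space *)

Section MetricFacts.
Context {R : realType} {X : finMetricType R}.

Lemma mdist_bounds : exists mu D : R, [/\ 0 < mu, mu <= D &
  forall x y : X, mdist x y <= D /\ (mdist x y < mu -> x = y)].
Proof.
(* [D] and [mu] will delimit the scales. The constants 1 give [mu <= 1 <= D], whatever the
   distances. *)
pose D : R := 1 + \sum_(e : X * X) mdist e.1 e.2.
pose mu : R := \big[Num.min/1]_(e : X * X | e.1 != e.2) mdist e.1 e.2.
have S0 (P : pred (X * X)) : 0 <= \sum_(e | P e) mdist e.1 e.2 :> R.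
  by apply: sumr_ge0 => e _; apply: mdist_ge0.
exists mu, D; split.
- rewrite /mu; elim/big_ind: _ => // [x y x0 y0|e e12]; last by rewrite mdist_gt0.
  by rewrite lt_min x0.
- apply: (@le_trans _ _ 1); last by rewrite lerDl.
  by apply: bigmin_le_id.
- move=> x y; split.
    by rewrite /D (bigD1 (x, y)) //= addrCA lerDl addr_ge0.
  move=> xy; apply/eqP; apply: contraTT xy => xy; rewrite -leNgt.
  by rewrite /mu (bigminD1 (x, y)) //= ge_min lexx.
Qed.

(** Decompose the whole space with [Delta] the distance of two distinct points: with positive
    probability they share a cluster, so its diameter bound [t * Delta] is at least [Delta]. *)
Lemma decomposable_ge1 (t beta : R) : (1 < #|X|)%N ->
  (forall Y : {set X}, decomposable Y t (#|Y|%:R `^ (- beta))) -> 1 <= t.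
Proof.
move=> X1 dec; have /card_gt1P[x [y [_ _ xy]]] := X1.
have d0 : 0 < mdist x y :> R by rewrite mdist_gt0.
have [mu [mu0 mu1] [supp cov]] := dec [set: X]%SET _ d0.
have : 0 < \sum_(P | same_cluster P x y) mu P.
  apply: lt_le_trans (cov x y _ _ (lexx _)); rewrite ?finset.in_setT//.
  by rewrite powR_gt0// ltr0n cardsT ltnW.
case: (pickP (fun P => same_cluster P x y && (mu P != 0))) => [P /andP[sP mP] _|no].
  have [_ dP] := supp P mP; have /exists_inP[A AP /andP[xA yA]] := sP.
  have := dP A AP x y xA yA.
  by rewrite -[leLHS]mul1r ler_pM2r.
rewrite big1 ?ltxx// => P sP; apply/eqP.
by have := no P; rewrite sP /= => /negbFE.
Qed.

Lemma exists_expr_gt (q x : R) : 1 < q -> exists J : nat, x < q ^+ J.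
Proof.
move=> q1; have q0 : 0 < q - 1 by rewrite subr_gt0.
exists (Num.bound `|x / (q - 1)|).
set J := Num.bound _.
have xJ : x < J%:R * (q - 1).
  by rewrite -ltr_pdivrMr//; apply: le_lt_trans (ler_norm _) (archi_boundP (normr_ge0 _)).
apply: lt_le_trans xJ _; elim: J => [|J IH]; first by rewrite mul0r expr0.
rewrite exprS -natr1 mulrDl mul1r.
have : 1 <= q ^+ J by rewrite exprn_ege1// ltW.
nra.
Qed.

Lemma mst_gt0 : (1 < #|X|)%N -> 0 < mst_weight X.
Proof.
move=> X1; have [mu [D' [mu0 _ sep]]] := mdist_bounds.
have : mu * #|X|%:R <= 8 * mst_weight X.
  rewrite -cardsT; apply: packing_mst; first by rewrite cardsT.
  by move=> x y _ _; apply: contraNT; rewrite -ltNge => /(sep x y).2->.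
have : 0 < mu * #|X|%:R :> R by rewrite mulr_gt0// ltr0n ltnW.
lra.
Qed.

End MetricFacts.

Lemma sum_seq_le (R : numDomainType) (T : eqType) (s : seq T) (F : T -> R) (c : R) :
  (forall f, f \in s -> F f <= c) -> \sum_(f <- s) F f <= (size s)%:R * c.
Proof.
elim: s => [|f s IH] Fc; first by rewrite big_nil mul0r.
rewrite big_cons /= -natr1 mulrDl mul1r addrC lerD ?Fc ?mem_head//.
by apply: IH => g gs; rewrite Fc// in_cons gs orbT.
Qed.

(** * The spanner *)

Section Construction.
Context {R : realType} {X : finMetricType R}.
Variables (t beta : R).
Hypothesis X1 : (1 < #|X|)%N.
Hypothesis beta0 : 0 < beta.
Hypothesis beta1 : beta < 1.
Hypothesis dec : forall Y : {set X}, decomposable Y t (#|Y|%:R `^ (- beta)).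

Let n : R := #|X|%:R.

(** The number of maps is bounded through [#|Y|] rather than [n]: coarse nets are small, which the
    lightness bound exploits. *)
Lemma star_family (Y : {set X}) (Delta : R) (lev : X -> nat) :
  (0 < #|Y|)%N -> 0 < Delta ->
  exists s : seq {ffun X -> X},
    [/\ (size s)%:R <= 3 * #|Y|%:R `^ beta * log2 n,
      forall f x, f \in s -> x \notin Y -> f x = x,
      forall f x, f \in s -> x \in Y ->
        [/\ f x \in Y, mdist x (f x) <= t * Delta & (lev (f x) <= lev x)%N] &
      forall x y, x \in Y -> y \in Y -> mdist x y <= Delta ->
        exists2 f, f \in s & f x = f y].
Proof.
move=> Y0 D0; have Y0' : 0 < #|Y|%:R :> R by rewrite ltr0n.
have d0 : 0 < #|Y|%:R `^ (- beta) :> R by apply: powR_gt0.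
have d1 : #|Y|%:R `^ (- beta) <= 1 :> R.
  by rewrite -[leRHS](powRr0 #|Y|%:R) ler_powR ?ler1n// oppr_le0 ltW.
have [m [mbig msmall]] := sample_size X1 d0 d1.
have [s [sm out inside cov]] := star_cover lev (dec Y) D0 d1 mbig.
exists s; split=> //; rewrite sm; apply: le_trans msmall _.
by rewrite powRN invrK.
Qed.

Variable e : R.
Hypothesis e0 : 0 < e.
Hypothesis e1 : e <= 1 / 100.
Variables (D : R) (J : nat) (N : nat -> {set X}).
Hypothesis D0 : 0 < D.

Let Delta j := D / (1 + e) ^+ j.

Hypothesis N_sep : forall j x y, x \in N j -> y \in N j -> x != y ->
  e * Delta j <= mdist x y.
Hypothesis N_mono : forall i j, (i <= j)%N -> N i \subset N j.
Hypothesis N_cov : forall j x, exists2 y, y \in N j & mdist x y <= e * Delta j.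
Hypothesis D_diam : forall x y : X, mdist x y <= D.
Hypothesis J_fine : forall x y : X, mdist x y <= Delta J -> x = y.

(** The first scale whose net contains [x], or [J] if there is none below [J], a case excluded for
    points of the nets in use. *)
Let lev x := find (fun j => x \in N j) (iota 0 J).

Let Delta_gt0 j : 0 < Delta j.
Proof. by have e_gt0 := e0; rewrite divr_gt0// exprn_gt0//; lra. Qed.

Let t_ge1 : 1 <= t. Proof. exact: decomposable_ge1 X1 dec. Qed.

Let levP j x : x \in N j -> (j < J)%N -> (lev x <= j)%N /\ x \in N (lev x).
Proof.
move=> xN jJ; have hasx : has (fun j => x \in N j) (iota 0 J).
  by apply/hasP; exists j; rewrite // mem_iota.
split; last first.
  by have := nth_find 0%N hasx; rewrite nth_iota//; rewrite has_find size_iota in hasx.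
rewrite leqNgt; apply/negP => /(before_find 0%N).
by rewrite nth_iota// add0n xN.
Qed.

(** The maps serve distances up to [(1 + 2 * e) * Delta j] because moving a pair at distance
    [Delta j] to nearby net points adds up to [e * Delta j] at each end. *)
Variable S : nat -> seq {ffun X -> X}.
Hypothesis S_size : forall j, (size (S j))%:R <= 3 * #|N j|%:R `^ beta * log2 n.
Hypothesis S_out : forall j f x, f \in S j -> x \notin N j -> f x = x.
Hypothesis S_in : forall j f x, f \in S j -> x \in N j ->
  [/\ f x \in N j, mdist x (f x) <= t * ((1 + 2 * e) * Delta j) &
      (lev (f x) <= lev x)%N].
Hypothesis S_cov : forall j x y, x \in N j -> y \in N j ->
  mdist x y <= (1 + 2 * e) * Delta j -> exists2 f, f \in S j & f x = f y.

Let H := star_graph (flatten [seq S j | j <- iota 0 J]).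

(** Induction from the finest scale up, [k] being the number of scales left before [J]; at scale [J]
    the points coincide. *)
Let H_spanner : spanner (t * (2 + 16 * e)) H.
Proof.
have e_gt0 := e0; have e_le := e1; have t1 := t_ge1.
apply: walk_le_spanner.
suff wk k : forall j, (j + k)%N = J -> forall x y, mdist x y <= Delta j ->
    walk_le H x y (t * (2 + 16 * e) * mdist x y).
  move=> x y; apply: (wk J 0%N) => //.
  by rewrite /Delta expr0 divr1.
elim: k => [|k IH] j jk x y xy.
  rewrite addn0 in jk; rewrite jk in xy; rewrite (J_fine xy) mdistxx mulr0.
  exact: walk_le_refl.
have [xyS|xyS] := lerP (mdist x y) (Delta j.+1).
  by apply: IH xyS; rewrite addSnnS.
have DS : Delta j = (1 + e) * Delta j.+1.
  by rewrite /Delta exprS; field; rewrite gt_eqF ?exprn_gt0 //; lra.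
have Dj := Delta_gt0 j.+1.
have [u uN xu] := N_cov j x; have [v vN yv] := N_cov j y.
have small : e * Delta j <= Delta j.+1 by rewrite DS; nra.
have K0 : 0 <= t * (2 + 16 * e) by nra.
have wxu := IH j.+1 (etrans (addSnnS _ _) jk) x u (le_trans xu small).
have wvy : walk_le H v y (t * (2 + 16 * e) * mdist v y).
  apply: (IH j.+1); first by rewrite addSnnS.
  by rewrite metric_sym; apply: le_trans small.
have uv : mdist u v <= (1 + 2 * e) * Delta j.
  have := metric_triangle u x v; have := metric_triangle x y v.
  by rewrite (metric_sym u x); lra.
have [f fS fuv] := S_cov uN vN uv.
have [_ duf _] := S_in fS uN; have [_ dvf _] := S_in fS vN.
have wuv : walk_le H u v (mdist u (f u) + mdist v (f v)).
  apply: walk_le_star fuv; apply/flattenP; exists (S j) => //.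
  by apply: map_f; rewrite mem_iota /= add0n -jk -addSnnS leq_addr.
apply: walk_le_weaken (walk_le_trans wxu (walk_le_trans wuv wvy)).
rewrite (metric_sym v y).
have hx : t * (2 + 16 * e) * mdist x u <= t * (2 + 16 * e) * (e * Delta j).
  by rewrite ler_wpM2l.
have hy : t * (2 + 16 * e) * mdist y v <= t * (2 + 16 * e) * (e * Delta j).
  by rewrite ler_wpM2l.
have hd : t * (2 + 16 * e) * Delta j.+1 <= t * (2 + 16 * e) * mdist x y.
  by rewrite ler_wpM2l// ltW.
(* Two detours and two star edges, in units of [t * Delta j.+1]. The left side is
   [2 + 10 * e + 40 * e ^+ 2 + 32 * e ^+ 3], so 16 leaves room for the higher powers. *)
have poly : (2 * e * (2 + 16 * e) + 2 * (1 + 2 * e)) * (1 + e) <= 2 + 16 * e.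
  have : e ^+ 2 <= e / 100 by nra.
  have : e ^+ 3 <= e / 10000 by nra.
  lra.
have : t * Delta j.+1 * ((2 * e * (2 + 16 * e) + 2 * (1 + 2 * e)) * (1 + e))
    <= t * Delta j.+1 * (2 + 16 * e).
  by rewrite ler_wpM2l// mulr_ge0//; lra.
rewrite DS in hx hy duf dvf; lra.
Qed.

Let sum_S (F : {ffun X -> X} -> R) :
  \sum_(f <- flatten [seq S j | j <- iota 0 J]) F f =
    \sum_(j < J) \sum_(f <- S j) F f.
Proof.
have -> : iota 0 J = index_iota 0 J by rewrite /index_iota subn0.
by rewrite big_flatten big_map big_mkord.
Qed.

Let B : R := 7 / e ^+ 2 * Num.max 1 (log2 t).

Let B_ge0 : 0 <= B.
Proof. by rewrite mulr_ge0 ?divr_ge0 ?exprn_ge0 ?(ltW e0)// le_max ler01. Qed.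

Let count_levels l :
  \sum_(j < J) ((l <= j)%N && ((1 + e) ^+ (j - l) * e <= 2 * t))%:R <= B.
Proof.
have e_gt0 := e0; have e_le := e1; have t1 := t_ge1.
set b := Num.truncn B; have /andP[bB Bb] := truncn_itv B_ge0.
apply: le_trans bB; rewrite -natr_sum ler_nat.
(* By [level_span] every counted scale lies in this window: [j - l >= b] would force [b + 1 <= B],
   but [b] is the integer part of [B]. *)
pose P := [pred j : 'I_J | (l <= j < l + b)%N].
have cardP : (#|P| <= b)%N.
  rewrite cardE -(size_map val) -(size_iota l b); apply: uniq_leq_size.
    by rewrite map_inj_uniq ?enum_uniq//; exact: val_inj.
  by move=> _ /mapP[j + ->]; rewrite mem_enum mem_iota.
apply: leq_trans cardP; rewrite -sum1_card [leqRHS]big_mkcond leq_sum// => j _.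
case: andP => // -[lj span]; rewrite !finset.inE /= lj /= -ltn_subLR//.
have [//|bj] := ltnP (j - l) b.
have e_le1 : e <= 1 by lra.
have : b.+1%:R <= (j - l)%:R + 1 :> R by rewrite natr1 ler_nat.
move=> /le_trans /(_ (level_span e0 e_le1 t1 span)) /(lt_le_trans Bb).
by rewrite ltxx.
Qed.

(* The edge [x -- f x] has length at most [2 t Delta_j], and both its ends lie in
   the net of scale [lev x], which separates them by [e * Delta_(lev x)]. *)
Let star_edge_level j f x : (j < J)%N -> f \in S j -> f x != x ->
  (lev x <= j)%N && ((1 + e) ^+ (j - lev x) * e <= 2 * t).
Proof.
have e_gt0 := e0; have e_le := e1; have t1 := t_ge1.
move=> jJ fS fx; have xN : x \in N j.
  by apply: contraNT fx => xN; rewrite (S_out fS xN).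
have [cN dc lc] := S_in fS xN; have [lj xl] := levP xN jJ.
have [_ cl] := levP cN jJ; rewrite lj /=.
have cl' : f x \in N (lev x) by apply: (fintype.subsetP (N_mono lc)).
have := N_sep xl cl'; rewrite eq_sym fx => /(_ isT) sep.
have span : e * Delta (lev x) <= t * ((1 + 2 * e) * Delta j) := le_trans sep dc.
have q0 : 0 < 1 + e by lra.
have DE : Delta (lev x) = (1 + e) ^+ (j - lev x) * Delta j.
  rewrite /Delta -{2}(subnK lj) exprD; field.
  by rewrite !gt_eqF ?exprn_gt0.
have Dj := Delta_gt0 j; rewrite DE in span; rewrite -(ler_pM2r Dj).
have : t * (2 * e) * Delta j <= t * Delta j.
  by rewrite ler_pM2r// ler_piMr//; lra.
lra.
Qed.

Let size_S_le j : (size (S j))%:R <= 3 * n `^ beta * log2 n.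
Proof.
apply: le_trans (S_size j) _; rewrite ler_wpM2r//.
  by apply: le_trans ler01 (log2_ge1 X1).
rewrite ler_wpM2l// ge0_ler_powR ?nnegrE ?(ltW beta0)//.
by rewrite ler_nat max_card.
Qed.

(** Double counting: a map of scale [j] moves only points whose level is close enough to [j], and a
    point is in that position for at most [B] scales. *)
Let H_edges : (nb_edges H)%:R <= 3 * n `^ beta * log2 n * (n * B).
Proof.
apply: le_trans (nb_edges_star_graph _) _; rewrite sum_S.
pose A (j : nat) x := (lev x <= j)%N && ((1 + e) ^+ (j - lev x) * e <= 2 * t).
apply: (@le_trans _ _ (\sum_(j < J) 3 * n `^ beta * log2 n * \sum_x (A j x)%:R)).
  apply: ler_sum => j _.
  apply: le_trans (sum_seq_le (c := \sum_x (A j x)%:R) _) _ => [f fS|].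
    rewrite -sum1_card natr_sum big_mkcond ler_sum// => x _.
    case: ifP => [fx|_]; last by [].
    by rewrite /A (star_edge_level (ltn_ord j) fS fx).
  by rewrite ler_wpM2r ?size_S_le// sumr_ge0.
rewrite -mulr_sumr ler_wpM2l//; first exact: le_trans (size_S_le 0).
rewrite exchange_big /=; apply: (@le_trans _ _ (\sum_(x : X) B)).
  by apply: ler_sum => x _; exact: count_levels.
by rewrite sumr_const mulr_natl.
Qed.

Let H_weight :
  weight H <= 288 / e ^+ 2 * (t / beta * n `^ beta * log2 n) * mst_weight X.
Proof.
have e_gt0 := e0; have e_le := e1; have t1 := t_ge1; have b_gt0 := beta0.
apply: le_trans (weight_star_graph _) _; rewrite sum_S.
(* The packing bound needs two points; a one-point net carries no proper star edge, so [c j] may be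
   0 there. *)
pose c j : R := if (1 < #|N j|)%N then #|N j|%:R else 0.
have c0 j : 0 <= c j by rewrite /c; case: ifP.
have cn j : c j <= n by rewrite /c; case: ifP => // _; rewrite ler_nat max_card.
have log0 : 0 <= log2 n by apply: le_trans ler01 (log2_ge1 X1).
pose a := 8 * mst_weight X / e.
have a0 : 0 < a by rewrite divr_gt0 ?mulr_gt0 ?mst_gt0.
have ca j : Delta j * c j <= a.
  rewrite /c; case: ifP => [Nj|_]; last by rewrite mulr0 ltW.
  rewrite ler_pdivlMr// mulrC mulrA.
  by apply: packing_mst => // x y; exact: N_sep.
have star j f : f \in S j -> \sum_x mdist x (f x) <= c j * (t * (2 * Delta j)).
  move=> fS; rewrite /c; case: ltnP => [Nj|Nj].
    rewrite (bigID (mem (N j))) /= [X in _ + X]big1 ?addr0; last first.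
      by move=> x /(S_out fS)->; rewrite mdistxx.
    rewrite -sum1_card natr_sum mulr_suml ler_sum// => x xN; rewrite mul1r.
    have [_ dx _] := S_in fS xN; apply: le_trans dx _.
    rewrite ler_wpM2l ?ler_wpM2r ?(ltW (Delta_gt0 j))//; lra.
  rewrite mul0r big1// => x _.
  have [xN|xN] := boolP (x \in N j); last by rewrite (S_out fS xN) mdistxx.
  have [cN _ _] := S_in fS xN.
  have -> : f x = x by apply: (card_le1_eqP Nj).
  by rewrite mdistxx.
apply: (@le_trans _ _ (\sum_(j < J)
    6 * t * log2 n * (Delta j * c j * c j `^ beta))).
  apply: ler_sum => j _; apply: le_trans (sum_seq_le (@star j)) _.
  have [Nj|Nj] := ltnP 1 #|N j|; last first.
    have -> : c j = 0 by rewrite /c ltnNge Nj.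
    by rewrite !(mul0r, mulr0).
  have cE : c j = #|N j|%:R by rewrite /c Nj.
  have -> : 6 * t * log2 n * (Delta j * c j * c j `^ beta) =
      3 * #|N j|%:R `^ beta * log2 n * (c j * (t * (2 * Delta j))).
    by rewrite cE; move: (_ `^ beta) (log2 n) => p l; ring.
  apply: (ler_wpM2r _ (S_size j)).
  have Dj := Delta_gt0 j; apply: mulr_ge0 => //.
  by apply: mulr_ge0; lra.
rewrite -mulr_sumr.
have n0 : 0 < n by rewrite ltr0n ltnW.
have e_le1 : e <= 1 by lra.
(* The 288 is 6 from the prefactor, 6 from [scale_sum] and 8 from [a]; the last two also bring one
   [1 / e] each. *)
have := scale_sum J e0 e_le1 beta0 beta1 n0 a0 D0 c0 cn ca.
have k0 : 0 <= 6 * t * log2 n by apply: mulr_ge0 => //; lra.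
move=> /(ler_wpM2l k0) /le_trans; apply; rewrite le_eqVlt; apply/orP; left.
apply/eqP; rewrite /a; move: (n `^ beta) (log2 n) (mst_weight X) => p l w.
by field; rewrite !gt_eqF.
Qed.

Lemma light_sparse_spanner : exists H : sgraph X,
  [/\ spanner (t * (2 + 16 * e)) H,
      weight H <= 288 / e ^+ 2 * (t / beta * n `^ beta * log2 n) * mst_weight X &
      (nb_edges H)%:R <= 3 * n `^ beta * log2 n * (n * (7 / e ^+ 2 * Num.max 1 (log2 t)))].
Proof. by exists H. Qed.

End Construction.

(** * Choice of scales, nets and maps, and the theorem *)

Lemma exists_light_sparse_spanner (R : realType) (X : finMetricType R) (t beta e : R) :
  (1 < #|X|)%N -> 0 < beta -> beta < 1 ->
  (forall Y : {set X}, decomposable Y t (#|Y|%:R `^ (- beta))) ->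
  0 < e -> e <= 1 / 100 ->
  exists H : sgraph X,
    [/\ spanner (t * (2 + 16 * e)) H,
        weight H <= 288 / e ^+ 2 * (t / beta * #|X|%:R `^ beta * log2 #|X|%:R)
          * mst_weight X &
        (nb_edges H)%:R <= 3 * #|X|%:R `^ beta * log2 #|X|%:R
          * (#|X|%:R * (7 / e ^+ 2 * Num.max 1 (log2 t)))].
Proof.
move=> X1 beta0 beta1 dec e0 e1.
have [mu [D [mu0 muD metric]]] := @mdist_bounds R X.
have D0 : 0 < D by apply: lt_le_trans muD.
have q1 : 1 < 1 + e by lra.
have q0 j : 0 < (1 + e) ^+ j by rewrite exprn_gt0//; lra.
(* With this [J] the last scale [D / (1 + e) ^+ J] is below [mu], so points that close coincide. *)
have [J DJ] := exists_expr_gt (D / mu) q1.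
have fine x y : mdist x y <= D / (1 + e) ^+ J -> x = y :> X.
  move=> xy; apply: (metric x y).2; apply: (le_lt_trans xy).
  by rewrite ltr_pdivrMr// mulrC -ltr_pdivrMr.
have [||N [N_sep N_mono N_cov]] :=
    @nested_nets R X (fun j => e * (D / (1 + e) ^+ j)).
- by move=> j; rewrite mulr_ge0 ?divr_ge0 ?ltW.
- move=> j; rewrite ler_pM2l// ler_pM2l// lef_pV2 ?posrE// exprS.
  by rewrite ler_peMl ?ltW.
(* Levels depend on the nets alone and are fixed before the maps, which must not raise them. *)
pose lev x := find (fun j => x \in N j) (iota 0 J).
have N0 j : (0 < #|N j|)%N.
  have /card_gt0P[x _] := ltnW X1.
  by have [y yN _] := N_cov j x; apply/card_gt0P; exists y.
have Delta0 j : 0 < (1 + 2 * e) * (D / (1 + e) ^+ j).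
  by rewrite mulr_gt0 ?divr_gt0//; lra.
have [S S_] := boolp.choice (fun j => star_family X1 beta0 dec lev (N0 j) (Delta0 j)).
apply: (light_sparse_spanner X1 beta0 beta1 dec e0 e1 D0 N_sep N_mono N_cov
  (fun x y => (metric x y).1) fine (S := S)) => j; by have [] := S_ j.
Qed.

(** [C] and [k] precede all other data, so the bounds are uniform. The maximum with 1 stands for
    [log2 t], which vanishes at [t = 1] although two points already need an edge. *)
Theorem theorem2 (R : realType) :
  exists (C : R) (k : nat), 0 < C /\
  forall (X : finMetricType R) (n : nat) (t beta : R),
    #|X| = n -> 0 < beta -> beta < 1 ->
    (forall Y : {set X}, decomposable Y t (#|Y|%:R `^ (- beta))) ->
  forall eps : R, 0 < eps -> eps < 1 / 8 ->
  exists H : sgraph X,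
    [/\ spanner (t * (2 + eps)) H,
        lightness H
          <= C * eps^-1 ^+ k * (t / beta * n%:R `^ beta * log2 n%:R) &
        (nb_edges H)%:R
          <= C * eps^-1 ^+ k *
             (n%:R `^ (1 + beta) * log2 n%:R * Num.max 1 (log2 t))].
Proof.
(* Both come from [288 / e ^+ 2] at [e = eps / 16]; the edge bound only needs [21 * 16 ^+ 2]. *)
exists (288 * 16 ^+ 2), 2%N.
split; first by apply: mulr_gt0; [exact: ltr0Sn|exact/exprn_gt0/ltr0Sn].
move=> X n t beta Xn beta0 beta1 dec eps eps0 eps1.
have [n1|n1] := leqP n 1; last first.
  have X1 : (1 < #|X|)%N by rewrite Xn.
  have e0 : 0 < eps / 16 by lra.
  have e1 : eps / 16 <= 1 / 100 by lra.
  have [H [spH wH eH]] := exists_light_sparse_spanner X1 beta0 beta1 dec e0 e1.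
  rewrite Xn in wH eH.
  have mst0 := mst_gt0 X1.
  have log1 := @log2_ge1 R n n1.
  exists H; split.
  - by move: spH; rewrite (_ : 16 * (eps / 16) = eps)//; field.
  - rewrite /lightness ler_pdivrMr//; apply: le_trans wH _.
    rewrite le_eqVlt; apply/orP; left; apply/eqP.
    move: (n%:R `^ beta) (log2 n%:R) (mst_weight X) => p l w.
    by field; rewrite !gt_eqF.
  - apply: le_trans eH _; have n0 : 0 < n%:R :> R by rewrite ltr0n ltnW.
    rewrite powRD; last by rewrite (gt_eqF n0) implybT.
    rewrite powRr1 ?(ltW n0)//.
    have : 0 <= n%:R `^ beta * log2 n%:R * (n%:R * Num.max 1 (log2 t)) / eps ^+ 2.
      apply: divr_ge0; last by rewrite exprn_ge0// ltW.
      have log0 : 0 <= log2 n%:R :> R by lra.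
      apply: mulr_ge0; first by rewrite mulr_ge0 ?powR_ge0.
      by rewrite mulr_ge0// le_max ler01.
    move: (n%:R `^ beta) (log2 n%:R) (Num.max 1 _) => p l M.
    have -> : 3 * p * l * (n%:R * (7 / (eps / 16) ^+ 2 * M)) =
        21 * 16 ^+ 2 * (p * l * (n%:R * M) / eps ^+ 2) by field; rewrite gt_eqF.
    have -> : 288 * 16 ^+ 2 * eps^-1 ^+ 2 * (n%:R * p * l * M) =
        288 * 16 ^+ 2 * (p * l * (n%:R * M) / eps ^+ 2) by field; rewrite gt_eqF.
    lra.
(* With at most one point both bounds are 0, [ln 0] being 0 by convention, and the edgeless graph
   meets them. *)
have log0 : log2 n%:R = 0 :> R.
  by rewrite /log2; case: n n1 {Xn} => [|[]]// _; rewrite ?ln1 ?(ln0 (lexx _)) mul0r.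
have eqX (x y : X) : x = y by apply: (card_le1_eqP (A := X)); rewrite // Xn.
exists (star_graph [::]); split.
- apply: walk_le_spanner => x y; rewrite (eqX y x) mdistxx mulr0.
  exact: walk_le_refl.
- rewrite log0 !mulr0 /lightness (_ : weight _ = 0) ?mul0r//.
  by rewrite /weight big1 ?mul0r// => -[x y] _; rewrite (eqX y x) mdistxx.
- rewrite log0 mulr0 mul0r mulr0.
  by apply: le_trans (nb_edges_star_graph _) _; rewrite big_nil.
Qed.
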